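(* Let $u>0$, $t\ge0$ with $\xi t/u-t+1>0$. Then $$\lim_{N\to+\infty}\left(\lim_{n\to+\infty}E[X_{N,n}]\right)=\exp\left(\int_I\log\left(a(x)t/u-t+1\right)d(F(x))\right),$$ where both sides may equal $+\infty$.
   Context: Setting: $I\subseteq\mathbb R$ is an interval, $F$ is a probability distribution function on $I$, and $\int_I g(x)\,d(F(x))$ is the Lebesgue–Stieltjes integral with respect to the associated probability measure. $a:I\to\mathbb R$ is measurable, $\xi:=\inf_{x\in I}a(x)>-\infty$, and $\xi$ is the essential infimum of $a$: $\int_{a(x)<\xi+\varepsilon}d(F(x))>0$ for all $\varepsilon>0$. $a$ is not a.e. constant. $\int_I a(x)\,d(F(x))\in(0,+\infty]$. $(f_N)_{N\ge1}$ is a sequence of step functions on $I$ with $\xi\le f_N(x)\le f_{N+1}(x)\le a(x)$ and $\lim_{N\to\infty}f_N(x)=a(x)$ for all $x\in I$. Each $f_N$ has finitely many levels $\xi=a_1<a_2<\dots<a_M$ ($M$ and the $a_j$ depending on $N$), with $f_N(x)=a_j$ when $a_j\le a(x)<a_{j+1}$ ($1\le j\le M-1$) and $f_N(x)=a_M$ when $a(x)\ge a_M$. (Example: $M=2^NN+1$, $a_j=\xi+(j-1)/2^N$.) Put $p_j:=\int_{a_j\le a(x)<a_{j+1}}d(F(x))$ for $j\le M-1$ and $p_M:=\int_{a(x)\ge a_M}d(F(x))$. For $u>0$, $t\ge0$ with $\xi t/u-t+1>0$, $X_{N,n}$ is the growth rate per attempt after $n$ attempts in the game $\{(a_j,p_j)\}$: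 $X_{N,n}=\left(\prod_{i=1}^n(Y_it/u-t+1)\right)^{1/n}$ with $Y_1,\dots,Y_n$ i.i.d., $P(Y_i=a_j)=p_j$. Thus $E[X_{N,n}]=\left(\sum_{j=1}^M(a_jt/u-t+1)^{1/n}p_j\right)^n$. *)

(* Defs.v *)
From HB Require Import structures.
From mathcomp Require Export all_boot all_order all_algebra finmap.
From mathcomp Require Export all_classical all_reals all_analysis measurable_realfun.
Export Order.TTheory GRing.Theory Num.Theory.
Export numFieldNormedType.Exports.

#[export] Set Implicit Arguments.
#[export] Unset Strict Implicit.
#[export] Unset Printing Implicit Defensive.

Local Open Scope classical_set_scope.
Local Open Scope ring_scope.

Definition mutually_independent d (T : measurableType d) (R : realType)
    (P : probability T R) (K : choiceType) (X : K -> T -> R) : Prop :=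
  forall (J : {fset K}) (B : K -> set R),
    (forall i, i \in J -> measurable (B i)) ->
    P (\bigcap_(i in [set` J]) (X i @^-1` B i)) =
    (\prod_(i <- J) P (X i @^-1` B i))%E.

(* Levels are numbered [lev 1 < ... < lev M]; [lev 0] and the values beyond [M]
   are irrelevant. For [j = M] the set is [a x >= lev M]. *)
Definition level_set (R : realType) (I : set R) (a : R -> R)
    (M : nat) (lev : nat -> R) (j : nat) : set R :=
  [set x | [/\ I x, lev j <= a x & (j < M)%N -> a x < lev j.+1]].

Definition step_approximation (R : realType) (I : set R) (a : R -> R) (xi : R)
    (f : R -> R) (M : nat) (lev : nat -> R) : Prop :=
  [/\ (1 <= M)%N,
      lev 1%N = xi,
      (forall j, (1 <= j < M)%N -> lev j < lev j.+1) &
      forall j, (1 <= j <= M)%N ->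
        forall x, level_set I a M lev j x -> f x = lev j].

(* The attempts are numbered from 0. *)
Definition growth_rate (R : realType) (T : Type) (u t : R)
    (Y : nat -> T -> R) (n : nat) : T -> R :=
  fun w => (\prod_(i < n) (Y i w * t / u - t + 1)) `^ (n%:R^-1).

(* Main.v *)
(** With c(y) = y t/u - t + 1, independence gives E[X_{N,n}] =
    (sum_j p_j c(a_j)^(1/n))^n, a power mean with exponent 1/n tending to 0, so
    its limit in n is the weighted geometric mean exp(sum_j p_j ln c(a_j)) =
    exp(int ln c(f_N)).  As c(f_N) increases to c(a) and is bounded below by
    c(xi) > 0, monotone convergence gives the limit in N, finite or not. *)
Require Import Defs.
From mathcomp Require Import lra.
Local Open Scope classical_set_scope.
Local Open Scope ring_scope.

(** * Power means as the exponent tends to 0 *)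

Lemma cvg_power_mean (R : realType) (m : nat) (p l : 'I_m -> R) :
  (forall j, 0 <= p j) -> \sum_j p j = 1 ->
  (\sum_j p j * expR (n%:R^-1 * l j)) ^+ n @[n --> \oo] -->
    expR (\sum_j p j * l j).
Proof.
move=> p0 p1.
(* The sequence is [exp (ln (g (1/n)) / (1/n))] with [ln (g 0) = 0], so the
   exponent tends to the derivative of [ln \o g] at 0. *)
pose g (s : R) := \sum_j p j * expR (s * l j).
have g0 : g 0 = 1.
  by rewrite /g -[RHS]p1; apply: eq_bigr => j _; rewrite mul0r expR0 mulr1.
have g_gt0 s : 0 < g s.
  have gs0 : 0 <= g s by apply: sumr_ge0 => j _; rewrite mulr_ge0// expR_ge0.
  rewrite lt_neqAle gs0 andbT eq_sym psumr_neq0 => [|j _]; last first.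
    by rewrite mulr_ge0// expR_ge0.
  (* The weights sum to 1, so one of them is nonzero, and its term makes the sum positive. *)
  have : \sum_j p j != 0 by rewrite p1 oner_neq0.
  rewrite psumr_neq0// => /hasP[j _ /= pj];
  apply/hasP; exists j; first exact: mem_index_enum.
  by rewrite /= pmulr_lgt0// expR_gt0.
have dg : is_derive (0 : R) (1 : R) g (\sum_j p j * l j).
  have -> : g = \sum_j (p j \*: (fun s => expR (s * l j))).
    by apply/funext => s; rewrite fct_sumE.
  apply: is_derive_sum => j.
  have h1 : is_derive (0 : R) (1 : R) (fun s : R => s * l j) (l j).
    by apply: is_derive_eq; rewrite scaler0 add0r /GRing.scale/= mulr1.
  have h2 := is_derive1_comp (is_derive_expR _) h1.
  apply: is_deriveZ.
  by apply: is_derive_eq; rewrite mul0r expR0 mul1r.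
have dlng : is_derive (0 : R) (1 : R) (@ln R \o g) (\sum_j p j * l j).
  have h : is_derive (g 0) (1 : R) (@ln R) (g 0)^-1 by exact: is_derive1_ln.
  by apply: is_derive_eq; rewrite g0 invr1 mul1r.
have quot : n%:R * ln (g n%:R^-1) @[n --> \oo] --> \sum_j p j * l j.
  have cv := @ex_derive _ _ _ _ _ _ _ dlng.
  move: (@derive_val _ _ _ _ _ _ _ dlng); rewrite /derive => dv.
  move: cv; rewrite /derivable dv /= g0 ln1 => cv.
  (* The difference quotient converges along punctured neighbourhoods of 0. Since [harmonic n] is
     1/(n+1), it never vanishes; the index shift by 1 below matches it with 1/n. *)
  have harm : (@harmonic R) n @[n --> \oo] --> (0:R)^'.
    move=> A A0; have hA :
        \forall n \near \oo, harmonic n != 0 :> R -> A (harmonic n).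
      exact: (@cvg_harmonic R _ A0).
    suff : \forall n \near \oo, A (harmonic n) by [].
    near=> n; have : harmonic n != 0 :> R -> A (harmonic n) by near: n.
    by apply; rewrite gt_eqF// harmonic_gt0.
  rewrite -(cvg_shiftn 1)/=; apply: cvg_trans (cvg_comp _ _ harm cv).
  by apply: near_eq_cvg; near=> n; rewrite /= addr0 subr0 invrK scaler1 addn1.
have -> : (fun n => (\sum_j p j * expR (n%:R^-1 * l j)) ^+ n) =
          (fun n => expR (n%:R * ln (g n%:R^-1))).
  by apply/funext => n; rewrite mulrC expRM_natr lnK ?posrE.
by apply: (cvg_comp _ _ quot); exact: continuous_expR.
Unshelve. all: end_near. Qed.

(** * Independence over the first n attempts *)

Lemma mutually_independent_values d (T : measurableType d) (R : realType)
    (P : probability T R) (Y : nat -> T -> R) (n : nat) (v : 'I_n -> R) :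
  mutually_independent P Y ->
  P (\bigcap_i Y (nat_of_ord i) @^-1` [set v i]) =
  (\prod_(i < n) P (Y i @^-1` [set v i]))%E.
Proof.
move=> indep.
(* Independence is stated for families indexed by all of [nat], so the n prescribed values are
   extended by the default [setT], which is never read on the index set {0, ..., n-1}. *)
pose B (k : nat) : set R := if insub k is Some i then [set v i] else setT.
have BE (i : 'I_n) : B i = [set v i] by rewrite /B valK.
have := indep (seq_fset tt (iota 0 n)) B.
rewrite (perm_big _ (seq_fset_perm _ _)) undup_id ?iota_uniq//.
rewrite -[X in iota _ X]subn0 big_mkord subn0.
under eq_bigr do rewrite BE.
move=> <-; last first.
  by move=> i _; rewrite /B; case: insubP => [j _ _|_]//;
    exact: measurable_set1.
have mE k : (k \in seq_fset tt (iota 0 n)) = (k < n)%N.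
  by rewrite seq_fsetE mem_iota.
congr (P _); apply/seteqP; split=> w Yw k kn.
  have kn' : (k < n)%N by rewrite -mE.
  by have := Yw (Ordinal kn') Logic.I; rewrite -BE.
by rewrite -BE; apply: Yw; rewrite /mkset mE.
Qed.

(** * Extended-real limits and integrals *)

(** At a finite limit this is continuity of [expR]; at +oo the bound 1 + x <= exp x transfers the
    divergence. *)
Lemma expeR_EFin_cvg (R : realType) (v : nat -> R) (l : \bar R) :
  (v n)%:E @[n --> \oo] --> l -> l != -oo%E ->
  (expR (v n))%:E @[n --> \oo] --> expeR l.
Proof.
case: l => [r| |] /=; last by [].
- move=> /fine_cvgP[_ vr] _; apply: cvg_EFin; first by near=> n.
  by apply: (cvg_comp _ _ vr); exact: continuous_expR.
- move=> /cvgeyPge vy _; apply/cvgeyPge => A; apply: filterS (vy A) => n.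
  rewrite !lee_fin => /le_trans; apply.
  by rewrite (le_trans _ (expR_ge1Dx _))// lerDr.
Unshelve. all: end_near. Qed.

(* [integralD] does not apply: the integral of [g] may be infinite and [k]
   negative. *)
Lemma ge0_integralD_cst d (T : measurableType d) (R : realType)
    (mu : {measure set T -> \bar R}) (D : set T) (g : T -> R) (k : R) :
  measurable D -> (mu D < +oo)%E -> measurable_fun D g ->
  (forall x, D x -> 0 <= g x) ->
  (\int[mu]_(x in D) (g x + k)%:E = \int[mu]_(x in D) (g x)%:E + k%:E * mu D)%E.
Proof.
move=> mD muD mg g0.
have kfin : (k%:E * mu D)%E \is a fin_num.
  by rewrite fin_numM// ge0_fin_numE.
have mgE : measurable_fun D (EFin \o g) by exact/measurable_EFinP.
have [k0|k0] := leP 0 k.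
  by rewrite -integral_cst// -ge0_integralD//.
pose f x := g x + k.
have mf : measurable_fun D (EFin \o f).
  by apply/measurable_EFinP; exact: measurable_funD.
(* From here k < 0. As g >= 0, the negative part of g + k is at most -k, hence has a finite
   integral. *)
have fneg x : D x -> ((EFin \o f)^\- x <= (- k)%:E)%E.
  move=> Dx; rewrite funenegE/= /f -EFin_max lee_fin ge_max.
  by have := g0 x Dx; lra.
have fneg_int : (\int[mu]_(x in D) (EFin \o f)^\- x)%E \is a fin_num.
  rewrite ge0_fin_numE ?integral_ge0//.
  apply: (@le_lt_trans _ _ (\int[mu]_(x in D) cst (- k)%:E x)%E).
    by apply: ge0_le_integral => //; exact: measurable_funeneg.
  by rewrite integral_cst// EFinN mulNe ltey_eq fin_numN kfin.
(* Pointwise, f = g + k reads f^+ - k = g + f^-. All four terms are nonnegative, so both sides can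
   be integrated termwise; the finite quantities are then moved across. *)
have E : (\int[mu]_(x in D) (EFin \o f)^\+ x - k%:E * mu D =
    \int[mu]_(x in D) (g x)%:E + \int[mu]_(x in D) (EFin \o f)^\- x)%E.
  rewrite -mulNe -EFinN -integral_cst// -!ge0_integralD//; last 3 first.
  - by apply: measurable_funeneg.
  - by apply: measurable_funepos.
  - by move=> x _; rewrite lee_fin oppr_ge0 ltW.
  apply: eq_integral => x _; rewrite funenegE funeposE /= /f -!EFin_max -!EFinD.
  congr (_%:E); rewrite /Num.max; do 2 case: ifPn; rewrite -?leNgt; lra.
rewrite [LHS]integralE -/(EFin \o f); move: E.
rewrite -(fineK fneg_int) -(fineK kfin).
move: (fine _) (fine _) (integral _ _ _) (integral _ _ _) => b c.
by move=> [x| |] [y| |]//= [xy]; congr (_%:E); lra.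
Qed.

(** * Functions constant on finitely many cells *)

Lemma measurable_fun_finite_cover d (T : measurableType d) (R : realType)
    (J : finType) (C : J -> set T) (X : T -> R) (k : J -> R) :
  (forall j, measurable (C j)) -> (forall j w, C j w -> X w = k j) ->
  measurable_fun (\big[setU/set0]_j C j) X.
Proof.
move=> mC XC _ B mB.
rewrite [X in measurable X](_ : _ = \big[setU/set0]_(j | k j \in B) C j).
  exact: bigsetU_measurable.
apply/seteqP; split=> w.
  rewrite -bigcup_seq => -[[j _ Cjw] /= Bw].
  rewrite -bigcup_seq_cond; exists j => //=.
  by rewrite mem_index_enum /= inE -(XC j w).
rewrite -bigcup_seq_cond => -[j /= /andP[_]]; rewrite inE => Bj Cjw.
split; last by rewrite /= (XC j w).
by rewrite -bigcup_seq; exists j => //=; exact: mem_index_enum.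
Qed.

Lemma integral_finite_partition d (T : measurableType d) (R : realType)
    (mu : {measure set T -> \bar R}) (J : finType) (C : J -> set T)
    (X : T -> R) (k : J -> R) :
  (forall j, measurable (C j)) -> trivIset setT C ->
  (forall j w, C j w -> X w = k j) ->
  (\int[mu]_(w in \big[setU/set0]_j C j) (X w)%:E =
    \sum_j (k j)%:E * mu (C j))%E.
Proof.
move=> mC tC XC.
rewrite integral_bigsetU_EFin ?index_enum_uniq//; last 2 first.
- exact: sub_trivIset tC.
- by apply/measurable_EFinP; exact: measurable_fun_finite_cover XC.
apply: eq_bigr => j _.
rewrite -integral_cst//; apply: eq_integral => w /set_mem Cw.
by rewrite (XC j).
Qed.

Lemma measure_finite_partition d (T : measurableType d) (R : realType)
    (mu : {measure set T -> \bar R}) (J : finType) (C : J -> set T) :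
  (forall j, measurable (C j)) -> trivIset setT C ->
  (mu (\big[setU/set0]_j C j) = \sum_j mu (C j))%E.
Proof.
move=> mC tC.
rewrite -bigcup_seq measure_fin_bigcup//; last exact: sub_trivIset tC.
by rewrite -fsbig_seq// index_enum_uniq.
Qed.

(** The cells have total probability 1, so what they leave out is negligible. This form is needed
    because the outcomes [Y i] take the prescribed values only almost surely. *)
Lemma ge0_integral_probability_partition d (T : measurableType d)
    (R : realType) (P : probability T R) (J : finType) (C : J -> set T)
    (X : T -> R) (k : J -> R) :
  (forall j, measurable (C j)) -> trivIset setT C ->
  (\sum_j P (C j) = 1)%E ->
  measurable_fun setT X -> (forall w, 0 <= X w) ->
  (forall j w, C j w -> X w = k j) ->
  (\int[P]_w (X w)%:E = \sum_j (k j)%:E * P (C j))%E.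
Proof.
move=> mC tC PC mX X0 XC.
pose D := \big[setU/set0]_j C j.
have mD : measurable D by exact: bigsetU_measurable.
rewrite (@ge0_negligible_integral _ _ _ _ _ (~` D))//=; last 4 first.
- exact: measurableC.
- exact/measurable_EFinP.
- by move=> w _; rewrite lee_fin.
- by rewrite probability_setC// /D measure_finite_partition// PC subee.
by rewrite setTD setCK; exact: integral_finite_partition.
Qed.

(** * Expected growth rate of a finite game *)

(** The sample space is cut, up to a null set, into cells [C s], one for each word [s] of n
    outcomes. The growth rate is constant on each cell, independence gives its probability as a
    product, and distributivity folds the sum over words into an n-th power. *)
Lemma expectation_growth_rate d (T : measurableType d) (R : realType)
    (P : probability T R) (Y : nat -> {RV P >-> R}) (u t : R)
    (m : nat) (v p : 'I_m -> R) (n : nat) :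
  mutually_independent P (fun i => Y i : T -> R) -> injective v ->
  (forall i j, P (Y i @^-1` [set v j]) = (p j)%:E) -> \sum_j p j = 1 ->
  (forall j, 0 < v j * t / u - t + 1) ->
  'E_P[growth_rate u t Y n]%E =
    ((\sum_j p j * expR (n%:R^-1 * ln (v j * t / u - t + 1))) ^+ n)%:E.
Proof.
move=> indep v_inj PY p1 c_gt0; rewrite unlock.
pose C (s : {ffun 'I_n -> 'I_m}) :=
  \bigcap_i (Y (nat_of_ord i) @^-1` [set v (s i)]).
pose k (s : {ffun 'I_n -> 'I_m}) :=
  \prod_i expR (n%:R^-1 * ln (v (s i) * t / u - t + 1)).
have mY i A : measurable A -> measurable (Y i @^-1` A).
  by move=> mA; rewrite -[X in measurable X]setTI; exact: measurable_funPT.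
have PC s : P (C s) = (\prod_i p (s i))%:E.
  rewrite (mutually_independent_values (fun i : 'I_n => v (s i)) indep).
  rewrite -prodEFin.
  by apply: eq_bigr => i _; rewrite PY.
rewrite (@ge0_integral_probability_partition _ _ _ P _ C _ k).
- under eq_bigr do rewrite PC -EFinM.
  rewrite sumEFin; congr EFin.
  rewrite -[X in _ ^+ X](card_ord n) -prodr_const bigA_distr_bigA/=.
  apply: eq_bigr => s _; rewrite /k -big_split/=.
  by apply: eq_bigr => i _; rewrite mulrC.
- move=> s; exact: fin_bigcap_measurable.
- move=> s s' _ _ [w [ws ws']]; apply/ffunP => i; apply: v_inj.
  by rewrite -(ws i Logic.I) -(ws' i Logic.I).
(* The same distributivity gives total mass (sum of the [p j])^n = 1. *)
- under eq_bigr do rewrite PC.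
  rewrite sumEFin; congr EFin.
  by rewrite -(bigA_distr_bigA (fun (_ : 'I_n) j => p j)) big1.
- apply: (measurableT_comp (measurable_powR _)); apply: measurable_prod => i _.
  have mYi : measurable_fun setT (Y i : T -> R) by exact: measurable_funPT.
  apply: measurable_funD => //; apply: measurable_funB => //.
  by do 2 apply: measurable_funM => //.
- by move=> w; exact: powR_ge0.
- move=> s w Csw; rewrite /growth_rate /k.
  (* Each factor is positive, hence the exponential of its logarithm; the n-th root then divides the
     exponent by n. *)
  have -> : \prod_(i < n) (Y i w * t / u - t + 1) =
            \prod_(i < n) expR (ln (v (s i) * t / u - t + 1)).
    by apply: eq_bigr => i _; rewrite (Csw i Logic.I) lnK// posrE.
  by rewrite -!expR_sum -expRM mulrC -mulr_sumr.
Qed.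

(** * Level sets of a step approximation *)

Lemma level_lt (R : realType) (M : nat) (lev : nat -> R) :
  (forall j, (1 <= j < M)%N -> lev j < lev j.+1) ->
  forall i j, (1 <= i)%N -> (i < j <= M)%N -> lev i < lev j.
Proof.
move=> levS i j i1; elim: j => // j IH /andP[ij jM].
have jlt : lev j < lev j.+1 by apply: levS; rewrite jM (leq_trans i1).
move: ij; rewrite ltnS leq_eqVlt => /predU1P[->//|ij].
by rewrite (lt_trans _ jlt)// IH// ij ltnW.
Qed.

(** Ordinals start at 0 and levels at 1, hence the shift [j.+1]. For i < j, the upper bound of cell
    i is at most the lower bound of cell j. *)
Lemma trivIset_level_set (R : realType) (I : set R) (a : R -> R) (M : nat)
    (lev : nat -> R) :
  (forall j, (1 <= j < M)%N -> lev j < lev j.+1) ->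
  trivIset setT (fun j : 'I_M => level_set I a M lev j.+1).
Proof.
move=> levS i j _ _ [x [[_ li ui] [_ lj uj]]]; apply: val_inj.
wlog ij : i j li ui lj uj / (i < j)%N => [wl|].
  case: (ltngtP i j) => // ij; first exact: wl.
  by apply/esym; exact: wl.
(* Since i < j, cell i is not the unbounded top cell, so its upper bound is available. *)
have : a x < lev i.+2 by apply: ui; rewrite (leq_ltn_trans ij).
have : lev i.+2 <= lev j.+1.
  move: ij; rewrite leq_eqVlt => /predU1P[->//|ij].
  by rewrite ltW// (level_lt levS)// !ltnS ij ltn_ord.
by move=> le /lt_le_trans/(_ le)/lt_le_trans/(_ lj); rewrite ltxx.
Qed.

(** A point lies in the cell of the last index whose level does not exceed [a x]; level 1 guarantees
    that there is such an index. *)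
Lemma bigcup_level_set (R : realType) (I : set R) (a : R -> R) (M : nat)
    (lev : nat -> R) :
  (1 <= M)%N -> (forall x, I x -> lev 1%N <= a x) ->
  \big[setU/set0]_(j < M) level_set I a M lev j.+1 = I.
Proof.
move=> M1 lev1; rewrite -bigcup_seq; apply/seteqP; split=> [x [j _ []]//|x Ix].
pose Q j := (j < M)%N && (lev j.+1 <= a x).
have exQ : exists j, Q j by exists 0%N; rewrite /Q M1 lev1.
have ubQ j : Q j -> (j <= M)%N by move=> /andP[/ltnW].
case: (ex_maxnP exQ ubQ) => j /andP[jM jx] jmax.
exists (Ordinal jM); first exact: mem_index_enum.
split=> //= jM'; rewrite ltNge; apply/negP => lejx.
by have := jmax j.+1; rewrite /Q jM' lejx ltnn => /(_ isT).
Qed.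

Lemma measurable_level_set (R : realType) (I : set R)
    (a : measurableTypeR R -> R) (M : nat) (lev : nat -> R) (j : nat) :
  measurable (I : set (measurableTypeR R)) -> measurable_fun I a ->
  measurable (level_set I a M lev j : set (measurableTypeR R)).
Proof.
move=> mI ma.
have -> : level_set I a M lev j =
  I `&` a @^-1` [set y | lev j <= y /\ ((j < M)%N -> y < lev j.+1)].
  by apply/seteqP; split=> x /= => [[]|[? []]].
apply: ma => //; have [jM|jM] := ltnP j M.
  have -> : [set y | lev j <= y /\ (true -> y < lev j.+1)] =
      `[lev j, lev j.+1[%classic.
    apply/seteqP; split=> y /=; rewrite in_itv/=.
      by move=> [-> /(_ isT) ->].
    by move=> /andP[].
  exact: measurable_itv.
have -> : [set y | lev j <= y /\ (false -> y < lev j.+1)] =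
    `[lev j, +oo[%classic.
  by apply/seteqP; split=> y /=; rewrite in_itv/= andbT // => -[].
exact: measurable_itv.
Qed.

(** * Monotone convergence for logarithms *)

(** Subtracting [ln c] makes the integrands nonnegative, so that monotone convergence applies; as D
    has mass 1, this changes each integral by exactly [ln c]. The same shift keeps the limit
    integral away from -oo. *)
Lemma cvg_integral_log (R : realType) d (T : measurableType d)
    (mu : {measure set T -> \bar R}) (D : set T) (g : nat -> T -> R)
    (h : T -> R) (c : R) :
  measurable D -> mu D = 1%E -> 0 < c ->
  (forall N, measurable_fun D (g N)) ->
  (forall N x, D x -> c <= g N x) ->
  (forall x, D x -> nondecreasing_seq (g ^~ x)) ->
  (forall x, D x -> g N x @[N --> \oo] --> h x) ->
  (\int[mu]_(x in D) (ln (g N x))%:E @[N --> \oo] -->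
    \int[mu]_(x in D) (ln (h x))%:E)%E /\
  (\int[mu]_(x in D) (ln (h x))%:E != -oo)%E.
Proof.
move=> mD D1 c0 mg cg ndg gh.
have ch x : D x -> c <= h x.
  move=> Dx; rewrite -(cvg_lim (@Rhausdorff R) (gh x Dx)).
  apply: limr_ge; first by apply/cvg_ex; exists (h x); exact: gh.
  by near=> N; exact: cg.
have mh : measurable_fun D h.
  by apply: (measurable_fun_cvg mg) => x Dx; exact: gh.
have mln (k : T -> R) : measurable_fun D k ->
    measurable_fun D (fun x => ln (k x) - ln c).
  by move=> mk; apply: measurable_funB => //; exact: measurableT_comp.
have ln_ge0 k : c <= k -> 0 <= ln k - ln c.
  by move=> ck; rewrite subr_ge0 ler_ln// posrE// (lt_le_trans c0).
have shift (k : T -> R) : measurable_fun D k -> (forall x, D x -> c <= k x) ->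
    (\int[mu]_(x in D) (ln (k x))%:E =
     \int[mu]_(x in D) (ln (k x) - ln c)%:E + (ln c)%:E)%E.
  move=> mk ck; rewrite -[X in (_ + X)%E]mule1 -D1.
  rewrite -ge0_integralD_cst//; last 3 first.
  - by rewrite D1 ltry.
  - exact: mln.
  - by move=> x Dx; rewrite ln_ge0// ck.
  by under [RHS]eq_integral do rewrite subrK.
split; last first.
  rewrite shift// -ltNye.
  apply: (@lt_le_trans _ _ (ln c)%:E); first exact: ltNyr.
  rewrite leeDr// integral_ge0// => x Dx; rewrite lee_fin ln_ge0//; exact: ch.
rewrite shift//.
under eq_cvg => N do rewrite (shift (g N) (mg N) (cg N)).
apply: cvgeD; [exact: fin_num_adde_defl| |exact: cvg_cst].
have -> : (\int[mu]_(x in D) (ln (h x) - ln c)%:E =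
  \int[mu]_(x in D) (fun x => limn (fun N => (ln (g N x) - ln c)%:E)) x)%E.
  apply: eq_integral => x /set_mem Dx; apply/esym/cvg_lim => //.
  apply: cvg_EFin; first by near=> N.
  apply: cvgB; last exact: cvg_cst.
  apply: (cvg_comp _ _ (gh x Dx)); apply: continuous_ln.
  by rewrite (lt_le_trans c0)// ch.
apply: cvg_monotone_convergence => //.
- by move=> N; apply/measurable_EFinP; exact: mln.
- by move=> N x Dx; rewrite lee_fin ln_ge0// cg.
- move=> x Dx n m nm; rewrite lee_fin lerD2r ler_ln ?posrE; first exact: ndg.
  + by rewrite (lt_le_trans c0)// cg.
  + by rewrite (lt_le_trans c0)// cg.
Unshelve. all: end_near. Qed.

(** * The iterated limit *)

Theorem lemma5p1
    (R : realType)
    (I : interval R)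
    (F : cumulativeBounded (0 : R) (1 : R))
    (F_on_I : lebesgue_stieltjes_measure F [set` I] = 1%E)
    (a : measurableTypeR R -> R)
    (a_meas : measurable_fun [set` I] a)
    (a_lb : has_lbound (a @` [set` I]))
    (xi : R)
    (xi_inf : xi = inf (a @` [set` I]))
    (xi_ess : forall e : R, 0 < e ->
      (0 < lebesgue_stieltjes_measure F
             ([set` I] `&` [set x | (a x < xi + e)%R]))%E)
    (a_not_const : ~ exists c : R,
      {ae lebesgue_stieltjes_measure F, forall x, [set` I] x -> a x = c})
    (a_int : (0 < \int[lebesgue_stieltjes_measure F]_(x in [set` I])
                    (a x)%:E)%E)
    (f : nat -> R -> R)
    (f_bounds : forall N x, [set` I] x ->
      [/\ xi <= f N x, f N x <= f N.+1 x & f N x <= a x])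
    (f_cvg : forall x, [set` I] x -> f N x @[N --> \oo] --> a x)
    (M : nat -> nat)
    (lev : nat -> nat -> R)
    (f_step : forall N,
      step_approximation [set` I] a xi (f N) (M N) (lev N))
    (d : nat -> measure_display)
    (Omega : forall N, measurableType (d N))
    (P : forall N, probability (Omega N) R)
    (Y : forall N, nat -> {RV (P N) >-> R})
    (Y_indep : forall N, mutually_independent (P N) (fun i => Y N i : Omega N -> R))
    (Y_dist : forall N i j, (1 <= j <= M N)%N ->
      P N [set w | Y N i w = lev N j] =
      lebesgue_stieltjes_measure F (level_set [set` I] a (M N) (lev N) j))
    (u t : R)
    (u_gt0 : 0 < u)
    (t_ge0 : 0 <= t)
    (ut_xi : 0 < xi * t / u - t + 1) :
  (forall N, cvg ('E_(P N)[growth_rate u t (Y N) n]%E @[n --> \oo])) /\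
  lim ('E_(P N)[growth_rate u t (Y N) n]%E @[n --> \oo]) @[N --> \oo] -->
    expeR (\int[lebesgue_stieltjes_measure F]_(x in [set` I])
             (ln (a x * t / u - t + 1))%:E)%E.
Proof.
pose mu : {measure set (measurableTypeR R) -> \bar R} :=
  lebesgue_stieltjes_measure F.
have mI : measurable ([set` I] : set (measurableTypeR R)).
  exact: measurable_itv.
pose c (y : R) := y * t / u - t + 1.
have c_le y z : y <= z -> c y <= c z.
  by move=> yz; rewrite /c lerD2r lerD2r ler_pM2r ?invr_gt0// ler_wpM2r.
pose L N (j : 'I_(M N)) : set (measurableTypeR R) :=
  level_set [set` I] a (M N) (lev N) j.+1.
have mL N j : measurable (L N j) by exact: measurable_level_set.
have tL N : trivIset setT (L N).
  by have [_ _ levS _] := f_step N; exact: trivIset_level_set.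
have LI N : \big[setU/set0]_(j < M N) L N j = [set` I].
  have [M1 lev1 _ _] := f_step N; apply: bigcup_level_set => // x Ix.
  by rewrite lev1; have [le1 _ le2] := f_bounds N x Ix; exact: le_trans le2.
have fL N j x : L N j x -> f N x = lev N j.+1.
  by have [_ _ _ h] := f_step N => Lx; apply: h Lx; exact: ltn_ord.
pose p N (j : 'I_(M N)) := fine (mu (L N j)).
have pE N j : mu (L N j) = (p N j)%:E by rewrite fineK// fin_num_measure.
have p_ge0 N j : 0 <= p N j by exact: fine_ge0.
have p1 N : \sum_j p N j = 1.
  apply: EFin_inj; rewrite -sumEFin -[RHS]F_on_I.
  under eq_bigr do rewrite -pE.
  by rewrite -(measure_finite_partition mu (mL N) (tL N)) LI.
(* The lowest level is [xi], where [ut_xi] gives positivity, and [c] is nondecreasing. *)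
have lev_gt0 N (j : 'I_(M N)) : 0 < c (lev N j.+1).
  have [_ lev1 levS _] := f_step N.
  apply: (lt_le_trans ut_xi); apply: c_le; rewrite -lev1.
  case: j => -[//|j] jM; rewrite ltW//; exact: (level_lt levS).
have lev_inj N : injective (fun j : 'I_(M N) => lev N j.+1).
  have [_ _ levS _] := f_step N => i j ij; apply: val_inj.
  have lev_neq (k l : 'I_(M N)) : (k < l)%N -> lev N k.+1 != lev N l.+1.
    by move=> kl; rewrite lt_eqF// (level_lt levS)// ltnS kl ltn_ord.
  case: (ltngtP i j) => // /lev_neq; first by rewrite ij eqxx.
  by rewrite -ij eqxx.
(* The logarithm of the weighted geometric mean, which is the inner limit. *)
pose ell N := \sum_j p N j * ln (c (lev N j.+1)).
have EX N : 'E_(P N)[growth_rate u t (Y N) n]%E @[n --> \oo] -->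
    (expR (ell N))%:E.
  have -> : (fun n => 'E_(P N)[growth_rate u t (Y N) n]%E) =
     (fun n => ((\sum_j p N j * expR (n%:R^-1 * ln (c (lev N j.+1)))) ^+ n)%:E).
    apply/funext => n.
    apply: expectation_growth_rate => // [i j|j]; last exact: lev_gt0.
    by rewrite -pE; apply: Y_dist; exact: ltn_ord.
  apply: cvg_EFin; first by near=> n.
  exact: cvg_power_mean.
split; first by move=> N; apply/cvg_ex; exists (expR (ell N))%:E.
have -> : (fun N => lim ('E_(P N)[growth_rate u t (Y N) n]%E @[n --> \oo])) =
   (fun N => (expR (ell N))%:E).
  by apply/funext => N; apply/cvg_lim => //; exact: EX.
(* The cells partition I and [f N] is constant on each, so the finite sum is an integral over I. *)
have ellE N : ((ell N)%:E = \int[mu]_(x in [set` I]) (ln (c (f N x)))%:E)%E.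
  pose k (j : 'I_(M N)) := ln (c (lev N j.+1)).
  have fk j x : L N j x -> ln (c (f N x)) = k j by move=> /fL ->.
  have := integral_finite_partition mu (mL N) (tL N) fk; rewrite LI => ->.
  by rewrite /ell -sumEFin; apply: eq_bigr => j _; rewrite pE -EFinM mulrC.
have mf N : measurable_fun ([set` I] : set (measurableTypeR R))
    (fun x => c (f N x)).
  have fk j x : L N j x -> c (f N x) = c (lev N j.+1) by move=> /fL ->.
  by have := measurable_fun_finite_cover (mL N) fk; rewrite LI.
(* As [xi <= f N x], the constant [c xi] is a positive lower bound uniform in N and x. *)
have [] := @cvg_integral_log R _ _ mu [set` I] (fun N x => c (f N x))
  (fun x => c (a x)) (c xi) mI F_on_I ut_xi mf.
- by move=> N x Ix; apply: c_le; have [] := f_bounds N x Ix.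
- move=> x Ix; apply/nondecreasing_seqP => N; apply: c_le.
  by have [] := f_bounds N x Ix.
- move=> x Ix; apply: cvgD; last exact: cvg_cst.
  apply: cvgB; last exact: cvg_cst.
  by do 2 (apply: cvgM; last exact: cvg_cst); exact: f_cvg.
move=> cv nNy; apply: expeR_EFin_cvg nNy.
by under eq_fun do rewrite ellE.
Unshelve. all: end_near. Qed.
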